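(* Let $t\ge 3$ be an integer and let $G$ be a finite simple graph that is strongly topologically $t$-chromatic. Then $$\psi(G)\ge \left\lfloor \frac{t}{2}\right\rfloor+2.$$
   Context: Graphs are finite and simple. The local chromatic number of a graph $G$ is $\psi(G):=\min_c\max_{v\in V(G)}|\{c(u):u\in N(v)\}|+1$, where $c$ ranges over all proper colorings of $G$ (with any number of colors) and $N(v)$ is the set of neighbors of $v$. A $\mathbb Z_2$-space is a topological space with a continuous involution; a $\mathbb Z_2$-map is a continuous map commuting with the involutions. The unit sphere $\mathbb S^d\subset\mathbb R^{d+1}$ carries the involution $x\mapsto -x$. The coindex of a $\mathbb Z_2$-space $T$ is $\mathrm{coind}(T)=\max\{d\ge 0:\text{there is a }\mathbb Z_2\text{-map }\mathbb S^d\to T\}$ ($\infty$ if such maps exist for all $d$). The box complex $B_0(G)$ is the simplicial complex on the vertex set $V(G)\times\{1,2\}$ whose members are the sets $S\uplus T:=S\times\{1\}\cup T\times\{2\}$ with $S,T\subseteq V(G)$, $S\cap T=\emptyset$, and every vertex of $S$ adjacent in $G$ to every vertex of $T$ (one or both of $S,T$ may be empty). Let $\|B_0(G)\|$ be its geometric realization, with the $\mathbb Z_2$-structure induced by swapping $(v,1)$ and $(v,2)$ for all $v$. The hom space $H(G)$ is the $\mathbb Z_2$-subspace of $\|B_0(G)\|$ consisting of those points whose representation $p=\sum_x\alpha_x\|x\|$ as a convex combination of the vertices of a simplex satisfies $\sum_{v\in V(G)}\alpha_{(v,1)}=1/2$. $G$ is strongly topologically $t$-chromatic if $\mathrm{coind}(H(G))\ge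 t-2$. *)

(* Defs.v *)
From HB Require Import structures.
From mathcomp Require Import all_boot all_order all_algebra.
From mathcomp Require Import all_classical all_reals all_analysis.

Set Implicit Arguments.
Unset Strict Implicit.
Unset Printing Implicit Defensive.

Import Order.TTheory GRing.Theory Num.Theory.
Import numFieldNormedType.Exports.

Local Open Scope classical_set_scope.
Local Open Scope ring_scope.

Record sgraph := SGraph {
  vertex :> finType;
  adj : rel vertex;
  adj_sym : symmetric adj;
  adj_irrefl : irreflexive adj
}.

(* A coloring of a finite graph uses finitely many colors, so [nat] provides
   an unlimited supply. *)
Definition proper_coloring (G : sgraph) (c : G -> nat) : Prop :=
  forall u v : G, adj u v -> c u <> c v.

Definition nb_colors (G : sgraph) (c : G -> nat) (v : G) : nat :=
  size (undup [seq c u | u <- enum G & adj v u]).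

Definition local_chromatic_value (G : sgraph) (k : nat) : Prop :=
  exists2 c : G -> nat,
    proper_coloring c & k = ((\max_(v : G) nb_colors c v) + 1)%N.

Lemma local_chromatic_value_ex (G : sgraph) :
  exists k, `[< local_chromatic_value G k >].
Proof.
exists ((\max_(v : G) nb_colors (fun u : G => val (enum_rank u)) v) + 1)%N.
apply/asboolP; exists (fun u : G => val (enum_rank u)) => //.
move=> u v uv /val_inj/enum_rank_inj uv_eq.
by move: uv; rewrite uv_eq adj_irrefl.
Qed.

Definition local_chromatic (G : sgraph) : nat :=
  ex_minn (local_chromatic_value_ex G).

Record z2space := Z2Space {
  z2_sort :> topologicalType;
  z2_inv : z2_sort -> z2_sort;
  z2_inv_continuous : continuous z2_inv;
  z2_invK : involutive z2_inv
}.

Definition z2_map (X Y : z2space) (f : X -> Y) : Prop :=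
  continuous f /\ forall x, f (z2_inv x) = z2_inv (f x).

Definition z2_invariant (X : z2space) (A : set X) : Prop :=
  forall x, A x -> A (z2_inv x).

Section Z2Subspace.
Variables (X : z2space) (A : set X) (invA : z2_invariant A).

Definition z2_subspace_inv (x : A) : A :=
  exist (fun y => y \in A) (z2_inv (val x)) (mem_set (invA (set_mem (valP x)))).

Lemma z2_subspace_inv_continuous : continuous z2_subspace_inv.
Proof.
apply: (@continuous_comp_initial A A X set_val).
move=> x; apply: (@continuous_comp A X X set_val (@z2_inv X)); last first.
  exact: z2_inv_continuous.
exact: initial_continuous.
Qed.

Lemma z2_subspace_invK : involutive z2_subspace_inv.
Proof. by move=> x; apply: val_inj; rewrite /= z2_invK. Qed.

Definition z2_subspace : z2space :=
  Z2Space z2_subspace_inv_continuous z2_subspace_invK.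

End Z2Subspace.

Section Sphere.
Variables (R : realType) (d : nat).

Lemma antipode_continuous :
  continuous (fun x : 'rV[R]_d.+1 => - x).
Proof. exact: opp_continuous. Qed.

Definition z2_euclidean : z2space :=
  Z2Space antipode_continuous (@opprK 'rV[R]_d.+1).

(* The norm provided on ['rV[R]_d.+1] is the sup norm; it induces the usual
   topology, but the sphere has to be given by the Euclidean equation. *)
Definition unit_sphere : set z2_euclidean :=
  [set x : 'rV[R]_d.+1 | \sum_(i < d.+1) x ord0 i ^+ 2 = 1].

Lemma unit_sphere_invariant : z2_invariant unit_sphere.
Proof.
move=> x; rewrite /unit_sphere /= => x1; rewrite -[RHS]x1.
by apply: eq_bigr => i _; rewrite mxE sqrrN.
Qed.

Definition sphere : z2space := z2_subspace unit_sphere_invariant.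

End Sphere.

(* The maximum of a set of natural numbers, with value [+oo] if the set is
   unbounded, and [-oo] if it is empty (that is, if [T] is empty). *)
Definition coind (R : realType) (T : z2space) : \bar R :=
  ereal_sup [set (d%:R)%:E | d in
    [set d : nat | exists f : sphere R d -> T, z2_map f]].

Lemma ptws_continuous (Y : topologicalType) (I : eqType) (T : topologicalType)
    (f : Y -> {ptws I -> T}) :
  (forall i, continuous (fun y => f y i)) -> continuous f.
Proof.
move=> cf y; apply/cvg_sup => i U [W [[V oV <-] Vx] sWU].
apply: (@filterS _ _ _ [set y | V (f y i)]).
  by move=> z Vz; exact: sWU.
by apply: (cf i y); exact: open_nbhs_nbhs.
Qed.

Section Realization.
Variables (R : realType) (X : finType).

(* Points [\sum_x alpha x ||x||] with nonzero weights on the vertices of some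
   simplex only. For finite [X], the geometric realization of the complex [K]
   carries the topology inherited from [X -> R]. *)
Definition realization (K : set {set X}) : set {ptws X -> R} :=
  [set alpha | [/\ forall x, 0 <= alpha x, \sum_x alpha x = 1 &
    exists2 A, K A & forall x, x \notin A -> alpha x = 0]].

Variables (s : X -> X) (sK : involutive s).

(* The point [\sum_x alpha x ||x||] is sent to [\sum_x alpha x ||s x||]. *)
Definition weight_inv (alpha : {ptws X -> R}) : {ptws X -> R} :=
  fun x => alpha (s x).

Lemma weight_inv_continuous : continuous weight_inv.
Proof.
apply: ptws_continuous => x.
exact: (@proj_continuous X (fun=> R) (s x)).
Qed.

Lemma weight_invK : involutive weight_inv.
Proof. by move=> alpha; apply/funext => x; rewrite /weight_inv sK. Qed.

Definition z2_weights : z2space := Z2Space weight_inv_continuous weight_invK.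

Variables (K : set {set X}) (KS : forall A : {set X}, K A -> K (s @: A)%SET).

Lemma realization_invariant : @z2_invariant z2_weights (realization K).
Proof.
move=> alpha [alpha_ge0 alpha1 [A KA alphaA]]; split.
- by move=> x; exact: alpha_ge0.
- by rewrite -alpha1 [RHS](reindex_inj (inv_inj sK)).
- exists (s @: A)%SET; first exact: KS.
  move=> x xA; apply: alphaA; apply: contra xA => sxA.
  by rewrite -[x]sK imset_f.
Qed.

Definition z2_realization : z2space := z2_subspace realization_invariant.

End Realization.

Section BoxComplex.
Variable G : sgraph.

(* [(v, false)] and [(v, true)] stand for the vertices (v, 1) and (v, 2). *)
Definition box_simplex (S T : {set G}) : {set G * bool} :=
  (finset.setX S [set false] :|: finset.setX T [set true])%SET.

Definition box_complex0 : set {set G * bool} :=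
  [set A | exists S T : {set G}, [/\ A = box_simplex S T,
    (S :&: T)%SET = finset.set0 & forall u v, u \in S -> v \in T -> adj u v]].

Definition box_swap (x : G * bool) : G * bool := (x.1, ~~ x.2).

Lemma box_swapK : involutive box_swap.
Proof. by case=> v b; rewrite /box_swap /= negbK. Qed.

Lemma box_complex0_swap (A : {set G * bool}) :
  box_complex0 A -> box_complex0 (box_swap @: A)%SET.
Proof.
move=> [S [T [-> dST ST]]]; exists T, S; split.
- apply/finset.setP => -[v b]; rewrite -[(v, b) in LHS]box_swapK.
  rewrite (mem_imset _ _ (inv_inj box_swapK)) !inE /=.
  by case: b; rewrite /= ?andbT ?andbF ?orbF.
- by rewrite finset.setIC.
- by move=> u v uT vS; rewrite adj_sym; exact: ST.
Qed.

Variable R : realType.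

Definition z2_box_complex0 : z2space :=
  @z2_realization R (G * bool)%type box_swap box_swapK box_complex0
    box_complex0_swap.

Definition hom_space_set : set z2_box_complex0 :=
  [set p : z2_box_complex0 | \sum_(v : G) val p (v, false) = 2^-1].

Lemma hom_space_invariant : z2_invariant hom_space_set.
Proof.
move=> p hp; have [_ p1 _] := set_mem (valP p).
have pE : \sum_x val p x =
    \sum_(v : G) val p (v, false) + \sum_(v : G) val p (v, true).
  transitivity (\sum_(v : G) \sum_(b : bool) val p (v, b)).
    by rewrite pair_bigA; apply: eq_bigr => -[].
  rewrite -big_split; apply: eq_bigr => v _.
  by rewrite big_bool /= addrC.
move: hp; rewrite /hom_space_set /= => hp.
move: p1; rewrite pE hp => p1.
apply: (addrI (2^-1 : R)); rewrite p1.
by rewrite {1}(splitr 1) div1r.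
Qed.

Definition hom_space : z2space := z2_subspace hom_space_invariant.

End BoxComplex.

Definition strongly_topologically_chromatic (R : realType) (G : sgraph)
    (t : nat) : Prop :=
  ((t%:R - 2)%:E <= coind R (hom_space G R))%E.

(* Main.v *)
Require Import Defs.
From mathcomp Require Import all_boot all_order all_algebra.
From mathcomp Require Import all_classical all_reals all_analysis.
From mathcomp Require Import zify lra.

(** Write [D] for [t - 2]. A Z2-map from a sphere of dimension at least [D] to
    the hom space labels the points of a fine antipodal grid on that sphere by
    vertices of [G]: the label [u x] is a vertex that carries a fixed share of
    the weight of the image of [x] on its first side. The second side of that
    image is the first side of the image of [- x], so uniform continuity makes
    [u x] and [u (- y)] adjacent as soon as [x] and [y] are close
    ([antipodal_labelling]). Compose [u] with a proper coloring in which every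
    vertex sees at most [k] colors, where [k.+1] is the local chromatic number.
    The result is a coloring [p] of the grid with [p x <> p (- y)] for close [x]
    and [y], and all the points of a small simplex have their colors among those
    seen by one vertex of [G], so they have at most [k] colors. It remains to see
    that [t / 2 < k] ([local_palette_bound]).

    This is done with cohomology modulo 2 on the grid. Put [q x = p (- x)] and
    let [c n] be the cochain that counts the ways to cut a simplex
    [v_0, ..., v_n] at a vertex [v_a] such that the [p]-colors of
    [v_0, ..., v_a] and the [q]-colors of [v_a, ..., v_n] are all distinct and,
    when they are sorted, alternate between the two families, a [p]-color
    coming first. The coboundary of [c n] is [c n.+1] plus its antipodal image.
    On the other hand the hemispheres of the grid carry chains [e i] such that
    the boundary of [e i.+1] is [e i] plus its antipodal image. Pairing these
    two staircases shows that [c D] takes the value 1 on the fundamental cycle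
    of the [D]-sphere, as it does in dimension 0
    ([transfer_alt_cochain_hemisphere]).

    Suppose that [k <= t / 2]. For odd [t] an alternating pattern of length [t]
    has [t / 2 + 1] colors of the first family, too many for a simplex, so
    [c D] is zero: a contradiction ([palette_bound_odd]). For even [t] the
    dimension is [D = 2 h] with [h = t / 2 - 1 >= 1], and [c D] is a sum of cup
    products of cochains of degree [h] that test for a given set of [h + 1]
    colors. Since [h + 2] points never have [h + 2] distinct colors, these
    cochains are cocycles, and the cohomology of a [2 h]-sphere vanishes in
    degree [h] ([cube_sphere_acyclic]). Hence [c D] is a coboundary and
    vanishes on the fundamental cycle, again a contradiction
    ([palette_bound_even]). *)

Set Implicit Arguments.
Unset Strict Implicit.
Unset Printing Implicit Defensive.
Import Order.TTheory GRing.Theory Num.Theory.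
Import numFieldNormedType.Exports.

(** * Cochains modulo 2 on ordered tuples *)

(** An [n]-cochain is a function on tuples of [n.+1] vertices, given as
    sequences: [coboundary a s] is the sum of [a] over the sequences obtained
    by deleting one entry of [s]. Entries may be repeated and the empty sequence
    is allowed, so that the complex is augmented: cohomology is reduced.
    A simplicial complex is a predicate on sequences, and only the values on
    its members matter. *)
Fixpoint coboundary (V : Type) (a : seq V -> bool) (s : seq V) : bool :=
  if s is x :: s' then a s' (+) coboundary (fun t => a (x :: t)) s' else false.

Lemma coboundary_map (V W : Type) (f : V -> W) (a : seq W -> bool) (s : seq V) :
  coboundary (fun t => a (map f t)) s = coboundary a (map f s).
Proof.
by elim: s a => //= x s IHs a; rewrite (IHs (fun t => a (f x :: t))).
Qed.

Section Cochains.
Variable V : eqType.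
Implicit Types (a b : seq V -> bool) (s t : seq V) (z : seq (seq V)).
Implicit Types (F : seq V -> seq V -> bool).

Lemma eq_coboundary a b s :
  (forall t, subseq t s -> (size t).+1 = size s -> a t = b t) ->
  coboundary a s = coboundary b s.
Proof.
elim: s a b => //= x s IHs a b ab; congr (_ (+) _).
  by apply: ab => //; exact: subseq_cons.
by apply: IHs => t ts sz; apply: ab; rewrite /= ?eqxx // sz.
Qed.

Lemma coboundaryD a b s : coboundary (fun t => a t (+) b t) s = coboundary a s (+) coboundary b s.
Proof.
elim: s a b => //= x s IHs a b; rewrite IHs.
by rewrite -!addbA; congr (_ (+) _); rewrite addbCA.
Qed.

Lemma coboundary0 s : coboundary (fun=> false) s = false.
Proof. by elim: s. Qed.

Lemma coboundary_sum (I : Type) (r : seq I) (P : pred I) (A : I -> seq V -> bool) s :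
  coboundary (fun t => \big[addb/false]_(i <- r | P i) A i t) s =
  \big[addb/false]_(i <- r | P i) coboundary (A i) s.
Proof.
elim: r => [|i r IHr].
  by rewrite big_nil -[RHS](coboundary0 s); apply: eq_coboundary => t _ _; rewrite big_nil.
rewrite big_cons -IHr; case: ifP => Pi; rewrite -?coboundaryD;
  by apply: eq_coboundary => t _ _; rewrite big_cons Pi.
Qed.

Lemma coboundaryZ (k : bool) a s : coboundary (fun t => k && a t) s = k && coboundary a s.
Proof.
by case: k => /=; [apply: eq_coboundary | rewrite coboundary0].
Qed.

Lemma coboundaryK a s : coboundary (coboundary a) s = false.
Proof.
elim: s a => //= x s IHs a.
by rewrite coboundaryD IHs addbF addbb.
Qed.

Lemma coboundary_cat a s t :
  coboundary a (s ++ t) =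
  coboundary (fun s' => a (s' ++ t)) s (+) coboundary (fun t' => a (s ++ t')) t.
Proof. by elim: s a => //= x s IHs a; rewrite IHs addbA. Qed.

Lemma coboundary_rev a s : coboundary (fun t => a (rev t)) s = coboundary a (rev s).
Proof.
elim: s a => //= x s IHs a.
rewrite rev_cons -cats1 coboundary_cat /= cats0 addbF addbC.
congr (_ (+) _).
rewrite -(IHs (fun t => a (t ++ [:: x]))).
by apply: eq_coboundary => t _ _; rewrite rev_cons -cats1.
Qed.

(** The total cup product: [F] is evaluated on all pairs of a front face and a
    back face that share a vertex. The prism operator of a homotopy has the same
    shape, so the Leibniz rule below serves both purposes. *)
Definition split_sum F s : bool :=
  \big[addb/false]_(i < size s) F (take i.+1 s) (drop i s).

Lemma split_sum_cons F x s :
  split_sum F (x :: s) = F [:: x] (x :: s) (+) split_sum (fun t => F (x :: t)) s.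
Proof. by rewrite /split_sum big_ord_recl /= take0. Qed.

Lemma eq_split_sum F F' s :
  (forall t t', {subset t <= s} -> {subset t' <= s} ->
      (size t + size t' = (size s).+1)%N -> t != [::] -> t' != [::] -> F t t' = F' t t') ->
  split_sum F s = split_sum F' s.
Proof.
move=> FF'; apply: eq_bigr => i _; have is_ := ltn_ord i.
apply: FF'; rewrite -?size_eq0 ?size_take_min ?size_drop.
- by move=> y /mem_take.
- by move=> y /mem_drop.
- by rewrite (minn_idPl is_) addSn subnKC // ltnW.
- by rewrite (minn_idPl is_).
- by rewrite subn_eq0 -ltnNge.
Qed.

Lemma split_sumD F F' s :
  split_sum (fun t t' => F t t' (+) F' t t') s = split_sum F s (+) split_sum F' s.
Proof. exact: big_split. Qed.

Lemma split_sum_rev F s :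
  split_sum F (rev s) = split_sum (fun t t' => F (rev t') (rev t)) s.
Proof.
rewrite /split_sum size_rev (reindex_inj rev_ord_inj) /=.
apply: eq_bigr => i _; have is_ := ltn_ord i.
rewrite take_rev drop_rev; congr (F (rev (drop _ _)) (rev (take _ _))).
  by rewrite subnSK // subKn // ltnW.
by rewrite subKn.
Qed.

(** The Leibniz rule. Deleting the last vertex of a front face and deleting the
    first vertex of the next back face give the same pair, so these terms
    telescope and only the two extreme ones remain. *)
Lemma coboundary_split_sum F s :
  coboundary (split_sum F) s =
  split_sum (fun t t' => coboundary (F^~ t') t (+) coboundary (F t) t') s
  (+) (F [::] s (+) F s [::]).
Proof.
elim: s F => [|x s IHs] F.
  by rewrite /= /split_sum big_ord0 addbb.
rewrite split_sum_cons [coboundary _ (x :: s)]/=.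
have -> : coboundary (fun t => split_sum F (x :: t)) s =
  coboundary (fun t => F [:: x] (x :: t)) s (+) coboundary (split_sum (fun t => F (x :: t))) s.
  by rewrite -coboundaryD; apply: eq_coboundary => t _ _; rewrite split_sum_cons.
rewrite IHs /=.
have -> : split_sum (fun t t' => F t t' (+) coboundary (fun t0 => F (x :: t0) t') t
      (+) coboundary (F (x :: t)) t') s =
   split_sum F s (+) split_sum
  (fun t t' => coboundary (fun t0 => F (x :: t0) t') t
      (+) coboundary (F (x :: t)) t') s.
  by rewrite -split_sumD; apply: eq_split_sum => t t' *; rewrite addbA.
by case: (F [::] _); case: (F [:: x] s); case: (F (x :: s) _);
  case: (split_sum F s); case: (coboundary _ s); case: (split_sum _ s).
Qed.

(** A chain is a list of simplices, which counts modulo 2 and is only used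
    through its pairing with cochains: to say that [z] is the boundary of [e] is
    to say that [pairing (coboundary a) e = pairing a z] for all [a]. *)
Definition pairing a z : bool := \big[addb/false]_(s <- z) a s.

Lemma eq_pairing a b z : {in z, a =1 b} -> pairing a z = pairing b z.
Proof. by move=> ab; apply: eq_big_seq. Qed.

Lemma pairingD a b z : pairing (fun s => a s (+) b s) z = pairing a z (+) pairing b z.
Proof. exact: big_split. Qed.

(** [E] is a chain contraction of the augmented complex of [K], given on
    simplices; its transpose contracts the cochains. One such [E] yields both
    the vanishing of cohomology and the fillings of cycles. *)
Definition contractible (K : pred (seq V)) : Prop :=
  exists E : seq V -> seq (seq V),
    (forall s, K s -> {in E s, forall t, K t /\ size t = (size s).+1}) /\
    (forall a s, K s ->
       coboundary (fun t => pairing a (E t)) s (+) pairing (coboundary a) (E s) = a s).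

Definition subset_closed (K : pred (seq V)) :=
  forall s t, {subset s <= t} -> K t -> K s.

Definition prism (f g : V -> V) s : seq (seq V) :=
  [seq map f (take i.+1 s) ++ map g (drop i s) | i <- iota 0 (size s)].

Lemma pairing_prism f g a s :
  pairing a (prism f g s) = split_sum (fun t t' => a (map f t ++ map g t')) s.
Proof.
rewrite /pairing /prism /split_sum big_map.
by rewrite -{1}(subn0 (size s)) -/(index_iota 0 (size s)) big_mkord.
Qed.

Lemma prism_homotopy f g a s :
  coboundary (fun t => pairing a (prism f g t)) s (+) pairing (coboundary a) (prism f g s)
  = a (map f s) (+) a (map g s).
Proof.
rewrite pairing_prism.
under eq_coboundary do rewrite pairing_prism.
rewrite coboundary_split_sum.
have -> : split_sum (fun t t' => coboundary a (map f t ++ map g t')) s =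
  split_sum (fun t t' => coboundary (fun t0 => a (map f t0 ++ map g t')) t
     (+) coboundary (fun t0 => a (map f t ++ map g t0)) t') s.
  apply: eq_split_sum => t t' *; rewrite coboundary_cat.
  by rewrite -(coboundary_map f (fun t => a (t ++ _))) -(coboundary_map g).
by rewrite addbAC addbb /= cats0 addbC.
Qed.

(** A homotopy in small steps from the identity to a map into a cone with apex
    [v]: the prisms of the steps and the cone over the end add up to a
    contraction. *)
Lemma contractible_homotopy (K : pred (seq V)) (f : nat -> V -> V) (L : nat) (v : V) :
  (forall s, K s -> map (f 0) s = s) ->
  (forall i s, K s -> K (map (f i) s ++ map (f i.+1) s)) ->
  (forall s, K s -> K (v :: map (f L) s)) ->
  subset_closed K ->
  contractible K.
Proof.
move=> f0 ff fL Ksub.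
exists (fun s => (v :: map (f L) s) ::
  flatten [seq prism (f i) (f i.+1) s | i <- iota 0 L]); split=> [s Ks t|a s Ks].
  rewrite inE => /orP[/eqP->|]; first by rewrite /= size_map; split=> //; exact: fL.
  move=> /flatten_mapP[i _ /mapP[j]]; rewrite mem_iota add0n /= => js ->.
  split; last first.
    rewrite size_cat !size_map size_take_min size_drop (minn_idPl js).
    by rewrite addSn subnKC // ltnW.
  apply: Ksub (ff i s Ks) => y; rewrite !mem_cat => /orP[]/mapP[x xs ->];
    apply/orP; [left|right]; apply: map_f; [exact: mem_take xs|exact: mem_drop xs].
have pE b t : pairing b ((v :: map (f L) t) ::
    flatten [seq prism (f i) (f i.+1) t | i <- iota 0 L]) =
  b (v :: map (f L) t) (+) \big[addb/false]_(i <- iota 0 L) pairing b (prism (f i) (f i.+1) t).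
  by rewrite /pairing big_cons big_flatten big_map.
rewrite pE; under eq_coboundary do rewrite pE.
rewrite coboundaryD coboundary_sum (coboundary_map (f L) (fun t => a (v :: t))) /=.
rewrite addbACA [X in _ (+) X](_ : _ = a s (+) a (map (f L) s)); last first.
  rewrite -big_split /=.
  have -> : a s = a (map (f 0) s) by rewrite f0.
  elim: L {fL pE} => [|L IHL]; first by rewrite big_nil addbb.
  rewrite -addn1 iotaD big_cat big_seq1 /= {}IHL add0n prism_homotopy addn1.
  by rewrite -addbA addKb.
by case: (coboundary _ _); case: (a s); case: (a _).
Qed.

(** Vanishing of the reduced cohomology of [K] for tuples of size [n], that is,
    in degree [n - 1]. *)
Definition acyclic_at (K : pred (seq V)) (n : nat) : Prop :=
  forall a, (forall s, K s -> size s = n.+1 -> coboundary a s = false) ->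
  exists u, forall s, K s -> size s = n -> coboundary u s = a s.

Lemma contractible_acyclic K n : contractible K -> acyclic_at K n.
Proof.
move=> [E [EK Eh]] a a0; exists (fun s => pairing a (E s)) => s Ks sz.
rewrite -[RHS](Eh a s Ks) [X in _ (+) X](_ : _ = false) ?addbF //.
rewrite /pairing big_seq big1 // => t /(EK _ Ks)[Kt szt].
by apply: a0; rewrite // szt sz.
Qed.

Lemma contractible_bounds K z :
  contractible K -> all K z -> (forall a, pairing (coboundary a) z = false) ->
  exists2 e, {in e, forall t, K t /\ exists2 s, s \in z & size t = (size s).+1}
   & forall a, pairing (coboundary a) e = pairing a z.
Proof.
move=> [E [EK Eh]] /allP zK zc; exists (flatten (map E z)).
  move=> t /flatten_mapP[s sz /(EK _ (zK _ sz))[Kt szt]]; split=> //.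
  by exists s.
move=> a; have -> : pairing a z =
    pairing a z (+) pairing (coboundary (fun s => pairing a (E s))) z.
  by rewrite zc addbF.
rewrite -pairingD /pairing big_flatten big_map.
apply: eq_big_seq => s /zK Ks.
by rewrite -[X in X (+) _](Eh a s Ks) addbAC addbb.
Qed.

(** The Mayer-Vietoris argument. *)
Lemma acyclic_union (K A B : pred (seq V)) n :
  subset_closed K -> subset_closed A -> subset_closed B ->
  (forall s, K s = A s || B s) ->
  acyclic_at A n.+1 -> acyclic_at B n.+1 -> acyclic_at (predI A B) n ->
  acyclic_at K n.+1.
Proof.
move=> Ks As Bs KAB accA accB accAB a a0.
have [|u uA] := accA a; first by move=> s As' sz; apply: a0; rewrite // KAB As'.
have [|v vB] := accB a; first by move=> s Bs' sz; apply: a0; rewrite // KAB Bs' orbT.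
have [|w wAB] := accAB (fun s => u s (+) v s).
  by move=> s /andP[sA sB] sz; rewrite coboundaryD uA // vB // addbb.
(* Primitives on the two pieces differ on the overlap by a cocycle of one
   degree less, hence by a coboundary, which corrects one of them. *)
exists (fun s => if A s then u s else v s (+) coboundary w s) => s sK sz.
have sub t : subseq t s -> {subset t <= s} by move=> /mem_subseq.
have [sA|sA] := boolP (A s).
  rewrite -uA //; apply: eq_coboundary => t /sub ts _.
  by rewrite (As _ _ ts sA).
have sB : B s by move: sK; rewrite KAB (negbTE sA).
rewrite -vB // -[RHS]addbF -(coboundaryK w s) -coboundaryD; apply: eq_coboundary => t /sub ts szt.
have tB := Bs _ _ ts sB.
case: ifP => // tA; rewrite wAB /= ?tA //.
  by rewrite [u t (+) _]addbC addKb.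
by move: szt; rewrite sz => -[].
Qed.

End Cochains.

(** * Alternating color patterns *)

Section SymmetricCochains.
Variable C : eqType.
Implicit Types (g : seq C -> bool) (s t : seq C).

Definition symmetric_cochain g := forall s t, perm_eq s t -> g s = g t.

Lemma coboundary_rem g s : symmetric_cochain g ->
  coboundary g s = \big[addb/false]_(x <- s) g (rem x s).
Proof.
elim: s g => [|x s IHs] g gS; first by rewrite big_nil.
rewrite big_cons /= eqxx IHs => [|t t' tt']; last by apply: gS; rewrite perm_cons.
congr (_ (+) _); apply: eq_big_seq => y ys; apply: gS.
case: eqP => [->|_] //.
by rewrite perm_sym; exact: perm_to_rem.
Qed.

Lemma symmetric_coboundary g : symmetric_cochain g -> symmetric_cochain (coboundary g).
Proof.
move=> gS s t st; rewrite !coboundary_rem // (perm_big _ st); apply: eq_big_seq => x xt.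
have xs : x \in s by rewrite (perm_mem st).
apply: gS; rewrite -(perm_cons x); apply: perm_trans (perm_to_rem xt).
by apply: perm_trans st; rewrite perm_sym perm_to_rem.
Qed.

Lemma perm_dup s : ~~ uniq s -> exists x t, perm_eq s [:: x, x & t].
Proof.
elim: s => // x s IHs /=; rewrite negb_and negbK => /orP[xs|/IHs[y [t st]]].
  by exists x, (rem x s); rewrite perm_cons perm_to_rem.
exists y, (x :: t); apply: (@perm_trans _ [:: x, y, y & t]).
  by rewrite perm_cons.
exact: (permEl (perm_catCA [:: x] [:: y; y] t)).
Qed.

(** The two deletions of a repeated entry cancel and all the other deletions
    keep the repetition. This is why the cochain that tests for a given set of
    [h + 1] colors is a cocycle wherever only [h + 1] colors meet. *)
Lemma coboundary_nonuniq g s : symmetric_cochain g -> (forall t, ~~ uniq t -> g t = false) ->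
  ~~ uniq s -> coboundary g s = false.
Proof.
move=> gS g0 /perm_dup[x [t st]]; rewrite (symmetric_coboundary gS st) /= addKb.
rewrite -[RHS](coboundary0 t); apply: eq_coboundary => t' _ _.
by apply: g0; rewrite /= inE eqxx.
Qed.

End SymmetricCochains.

Section Alternation.

(** The letters of [w], with blanks skipped, alternate, begin with [b] and are
    [n] in number. *)
Fixpoint alternating (b : bool) (n : nat) (w : seq (option bool)) : bool :=
  match w with
  | [::] => n == 0
  | None :: w' => alternating b n w'
  | Some c :: w' => if n is n'.+1 then (c == b) && alternating (~~ b) n' w' else false
  end.

Lemma alternating0 b w : alternating b 0 w = alternating true 0 w.
Proof. by elim: w => // -[]. Qed.

(** The combinatorial core. A word with [n.+1] letters that becomes alternating
    when a letter is erased either has exactly one pair of equal neighbors, and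
    then both of them can be erased, or is itself alternating; in the latter
    case erasing the last letter preserves the first one, and erasing the first
    letter changes it. Modulo 2 only the alternating words survive, whatever
    their first letter is. *)
Lemma alternating_erase (C : eqType) (L : seq C) (l : C -> option bool) b n : uniq L ->
  \big[addb/false]_(i <- L | isSome (l i))
     alternating b n [seq (if j == i then None else l j) | j <- L]
  = alternating b n.+1 (map l L) (+) alternating (~~ b) n.+1 (map l L).
Proof.
elim: L b n => [|i L IHL] b n; first by rewrite big_nil.
move=> /= /andP[iL uL]; rewrite big_cons eqxx /=.
have -> : [seq (if j == i then None else l j) | j <- L] = map l L.
  by apply/eq_in_map => j jL; case: eqP => // ji; rewrite -ji jL in iL.
rewrite [X in if _ then _ (+) X else _](_ : _ =
   \big[addb/false]_(j <- L | isSome (l j)) alternating b n (l i ::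
       [seq (if j0 == j then None else l j0) | j0 <- L])); last first.
  rewrite big_seq_cond [RHS]big_seq_cond; apply: eq_bigr => j /andP[jL _].
  by case: eqP => // ij; rewrite ij jL in iL.
rewrite [X in if _ then _ else X](_ : _ =
   \big[addb/false]_(j <- L | isSome (l j)) alternating b n (l i ::
       [seq (if j0 == j then None else l j0) | j0 <- L])); last first.
  rewrite big_seq_cond [RHS]big_seq_cond; apply: eq_bigr => j /andP[jL _].
  by case: eqP => // ij; rewrite ij jL in iL.
case: (l i) => [c|] /=; last exact: IHL.
(* An alternating word of length 0 has no letter at all, so only the erasure of
   the first letter counts. *)
case: n => [|n].
  rewrite big1 // addbF !(alternating0 (~~ _)) (alternating0 b).
  by case: c; case: b; rewrite /= ?addbF ?addFb.
have [->|cb] := eqVneq c b => /=.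
  have -> : (b == ~~ b) = false by case: b.
  by rewrite IHL // negbK /= addbF addbC -addbA addbb addbF.
rewrite big1 // addbF; have -> : c = ~~ b by case: c b cb => [] [].
by rewrite eqxx negbK.
Qed.

Lemma alternating_negb b n w : alternating (~~ b) n w = alternating b n (map (omap negb) w).
Proof.
elim: w b n => // -[c|] w IHw b n /=; last exact: IHw.
by case: n => // n; rewrite (IHw (~~ b)); case: c; case: b {IHw}.
Qed.

Lemma alternating_count b n w : alternating b n w ->
  count_mem (Some b) w = uphalf n /\ count_mem (Some (~~ b)) w = n./2.
Proof.
elim: w b n => [|[c|] w IHw] b n /=; first by move=> /eqP->.
  case: n => // n /andP[/eqP-> /IHw]; rewrite negbK => -[-> ->].
  by rewrite eqxx; case: b.
by move=> /IHw[-> ->].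
Qed.

Variable C : finType.
Implicit Types xs ys : seq C.

Definition letter xs ys i : option bool :=
  if i \in xs then Some true else if i \in ys then Some false else None.

(** The order of [enum C] serves as the order of the colors. Since the word only
    records membership, distinctness has to be required separately. *)
Definition alt_pair b n xs ys : bool :=
  [&& uniq xs, uniq ys & alternating b n (map (letter xs ys) (enum C))].

Lemma alt_pair_perm b n xs xs' ys ys' : perm_eq xs xs' -> perm_eq ys ys' ->
  alt_pair b n xs ys = alt_pair b n xs' ys'.
Proof.
move=> xx yy; rewrite /alt_pair (perm_uniq xx) (perm_uniq yy); congr [&& _, _ & alternating _ _ _].
by apply: eq_map => i; rewrite /letter (perm_mem xx) (perm_mem yy).
Qed.

Lemma alt_pair_swap b n xs ys : ~~ has (mem xs) ys ->
  alt_pair b n ys xs = alt_pair (~~ b) n xs ys.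
Proof.
move=> /hasPn xy; rewrite /alt_pair andbCA alternating_negb -map_comp.
congr [&& _, _ & alternating _ _ _]; apply: eq_map => i.
rewrite /letter /=; case: ifP => [/xy /= /negbTE-> //|_]; by case: ifP.
Qed.

(** An alternating word has its letters shared equally, up to one; this is what
    turns a bound on the number of colors into a contradiction. *)
Lemma alt_pair_size b n xs ys : ~~ has (mem xs) ys -> alt_pair b n xs ys ->
  size (if b then xs else ys) = uphalf n /\ size (if b then ys else xs) = n./2.
Proof.
move=> /hasPn xy /and3P[ux uy /alternating_count].
have xsE : count_mem (Some true) (map (letter xs ys) (enum C)) = size xs.
  rewrite count_map -(card_uniqP ux) cardE -size_filter enumT /enum_mem.
  by congr size; apply: eq_filter => i; rewrite /= /letter; case: ifP => // _; case: ifP.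
have ysE : count_mem (Some false) (map (letter xs ys) (enum C)) = size ys.
  rewrite count_map -(card_uniqP uy) cardE -size_filter enumT /enum_mem.
  congr size; apply: eq_filter => i; rewrite /= /letter.
  by case: (boolP (i \in ys)) => [/xy /= /negbTE->|_] //; case: ifP.
by case: b => /=; rewrite xsE ysE.
Qed.

Lemma big_uniq_enum xs (f : C -> bool) : uniq xs ->
  \big[addb/false]_(x <- xs) f x = \big[addb/false]_(x <- enum C | x \in xs) f x.
Proof.
move=> ux; rewrite -[RHS]big_filter; apply: perm_big; apply: uniq_perm => //.
  by rewrite filter_uniq // enum_uniq.
by move=> i; rewrite mem_filter mem_enum andbT.
Qed.

(** On repeated colors both sides vanish; on distinct ones, deleting a color
    means erasing a letter. *)
Lemma coboundary_alt_pair b n xs ys : ~~ has (mem xs) ys ->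
  coboundary (fun t => alt_pair b n t ys) xs (+) coboundary (alt_pair b n xs) ys =
  alt_pair b n.+1 xs ys (+) alt_pair (~~ b) n.+1 xs ys.
Proof.
move=> xy.
have symx ys' : symmetric_cochain (fun t => alt_pair b n t ys').
  by move=> s t st; apply: alt_pair_perm.
have symy xs' : symmetric_cochain (alt_pair b n xs').
  by move=> s t st; apply: alt_pair_perm.
have [ux|nux] := boolP (uniq xs); last first.
  rewrite coboundary_nonuniq //; last by move=> t /negbTE ut; rewrite /alt_pair ut.
  rewrite /alt_pair (negbTE nux) /= -[RHS](coboundary0 ys).
  by apply: eq_coboundary.
have [uy|nuy] := boolP (uniq ys); last first.
  rewrite addbC coboundary_nonuniq //; last first.
    by move=> t /negbTE ut; rewrite /alt_pair ut andbF.
  rewrite /alt_pair (negbTE nuy) /= !andbF -[RHS](coboundary0 xs).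
  by apply: eq_coboundary => t _ _; rewrite andbF.
rewrite !coboundary_rem // !big_uniq_enum //.
have := alternating_erase (letter xs ys) b n (enum_uniq C).
rewrite {3 4}/alt_pair ux uy /= => <-.
rewrite [RHS](bigID (mem xs)) /=; congr (_ (+) _).
  apply: eq_big => [i|i ix]; first by rewrite /letter; case: ifP; rewrite ?andbF.
  rewrite /alt_pair rem_uniq // uy /=; congr alternating; apply: eq_map => j.
  rewrite /letter mem_rem_uniq // inE.
  have [->|//] := eqVneq j i.
  by case: ifP => // iy; move/hasPn/(_ i iy): xy => /=; rewrite ix.
apply: eq_big => [i|i iy].
  rewrite /letter; case: (boolP (i \in ys)) => [/(hasPn xy)/= /negbTE-> //|].
  by case: ifP.
rewrite /alt_pair rem_uniq // ux /=; congr alternating; apply: eq_map => j.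
rewrite /letter mem_rem_uniq // inE.
have [->|//] := eqVneq j i.
by have /= /negbTE-> := hasPn xy _ iy.
Qed.

End Alternation.

(** * Antipodal chains and their colorings *)

Section Antipodal.
Variables (V : eqType) (nu : V -> V).
Hypothesis nuK : involutive nu.
Implicit Types (a : seq V -> bool) (K : pred (seq V)).

(** The order of the vertices is reversed so that the front faces of the image
    are the images of the back faces: the cup product of two cochains is then
    carried to a cup product with the factors exchanged, without the correction
    terms that the noncommutativity of cup products would bring. *)
Definition reverse_flip (s : seq V) := rev (map nu s).

Lemma reverse_flipK : involutive reverse_flip.
Proof. by move=> s; rewrite /reverse_flip map_rev revK mapK. Qed.

Lemma size_reverse_flip s : size (reverse_flip s) = size s.
Proof. by rewrite size_rev size_map. Qed.

(** The sum over an orbit of the antipodal action. *)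
Definition transfer a s : bool := a s (+) a (reverse_flip s).

Lemma transferK0 a s : transfer (transfer a) s = false.
Proof. by rewrite /transfer reverse_flipK [X in _ (+) X]addbC addbb. Qed.

Lemma transfer_coboundary a s : transfer (coboundary a) s = coboundary (transfer a) s.
Proof.
rewrite /transfer coboundaryD /reverse_flip; congr (_ (+) _).
by rewrite -coboundary_rev -(coboundary_map nu (fun t => a (rev t))).
Qed.

(** The last condition is the transposed form of: the boundary of [e i.+1]
    consists of [e i] and its antipodal image. *)
Definition hemisphere_chains (D : nat) (K : pred (seq V)) (e : nat -> seq (seq V)) :=
  [/\ exists v, e 0 = [:: [:: v]],
      forall i s, i <= D -> s \in e i -> K s /\ size s = i.+1
    & forall i a, i < D -> pairing (coboundary a) (e i.+1) = pairing (transfer a) (e i)].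

(** Each sphere bounds in the next hemisphere, which is contractible. *)
Lemma hemisphere_chains_exist (D : nat) (B : nat -> pred (seq V)) (v : V) :
  (forall i, i <= D -> contractible (B i)) ->
  (forall i s, i < D -> B i s -> B i.+1 s && B i.+1 (reverse_flip s)) ->
  B 0 [:: v] ->
  exists e, hemisphere_chains D (B D) e.
Proof.
move=> cB Bs B0.
have Bmono k i s : i + k <= D -> B i s -> B (i + k) s.
  elim: k => [|k IHk]; rewrite ?addn0 // addnS => ikD Bis.
  by have /andP[] := Bs _ _ ikD (IHk (ltnW ikD) Bis).
suff H n : n <= D -> exists2 e, e 0 = [:: [:: v]] &
   (forall i s, i <= n -> s \in e i -> B i s /\ size s = i.+1) /\
   (forall i a, i < n -> pairing (coboundary a) (e i.+1) = pairing (transfer a) (e i)).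
  have [e e0 [eB ed]] := H D (leqnn D); exists e; split => //; first by exists v.
  move=> i s iD /(eB _ _ iD)[sB ->]; split=> //.
  by rewrite -(subnKC iD); apply: Bmono; rewrite ?subnKC.
elim: n => [|n IHn] nD.
  exists (fun=> [:: [:: v]]) => //; split=> // i s; rewrite leqn0 => /eqP->.
  by rewrite inE => /eqP->.
have [e e0 [eB ed]] := IHn (ltnW nD).
(* The next hemisphere is bounded by the sphere made of the present one and its
   antipodal image. *)
pose z := e n ++ map reverse_flip (e n).
have zE a : pairing a z = pairing (transfer a) (e n).
  by rewrite pairingD /pairing big_cat big_map.
have [||e' e'B e'd] := contractible_bounds (z := z) (cB _ nD).
- apply/allP => s; rewrite mem_cat => /orP[/eB|/mapP[s' /eB]].
    by case=> // sB _; have /andP[] := Bs _ _ nD sB.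
  by case=> // sB _ ->; have /andP[] := Bs _ _ nD sB.
- move=> a; rewrite zE; under eq_pairing do rewrite transfer_coboundary.
  case: (n) ed e0 => [|k] ed e0; last first.
    by rewrite ed // /pairing big1 // => s _; rewrite transferK0.
  by rewrite e0 /pairing big_seq1 /= /transfer /= addbF addbb.
exists (fun i => if i == n.+1 then e' else e i) => //; split=> [i s|i a].
  rewrite leq_eqVlt => /orP[/eqP->|].
    rewrite eqxx => /e'B[sB [t tz ->]]; split=> //; congr _.+1.
    move: tz; rewrite mem_cat => /orP[/eB|/mapP[t' /eB]]; first by case.
    by case=> // _ <- ->; rewrite size_reverse_flip.
  by rewrite ltnS => i_n; rewrite ltn_eqF //; apply: eB.
rewrite ltnS leq_eqVlt => /orP[/eqP->|i_n].
  by rewrite eqxx ltn_eqF // e'd zE.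
by rewrite eqSS !ltn_eqF ?ed // ltnW.
Qed.

Section Coloring.
Variables (C : finType) (p : V -> C) (K : pred (seq V)).
Hypothesis Ksub : subset_closed K.
Hypothesis Knu : forall s, K s -> K (map nu s).
Hypothesis p_proper : forall s x y, K s -> x \in s -> y \in s -> p x != p (nu y).

Let q := p \o nu.

Lemma K_reverse_flip s : K s -> K (reverse_flip s).
Proof. by move=> /Knu; apply: Ksub => x; rewrite mem_rev. Qed.

(** The length [n.+2] is the total number of vertices of the two faces of an
    [n]-simplex, the cut vertex being counted twice. *)
Definition alt_cochain n : seq V -> bool :=
  split_sum (fun xs ys => alt_pair true n.+2 (map p xs) (map q ys)).

Lemma p_disjoint s xs ys : K s -> {subset xs <= s} -> {subset ys <= s} ->
  ~~ has (mem (map p xs)) (map q ys).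
Proof.
move=> Ks xss yss; apply/hasPn => c /mapP[y ys_y ->] /=; apply/negP => /mapP[x xs_x].
by move/eqP; rewrite eq_sym; apply/negP; apply: p_proper (Ks) _ _; auto.
Qed.

(** The words beginning with a [q]-color are the antipodal images of those
    beginning with a [p]-color. *)
Lemma coboundary_alt_cochain n s : K s ->
  coboundary (alt_cochain n) s = transfer (alt_cochain n.+1) s.
Proof.
move=> Ks; rewrite coboundary_split_sum.
have alt_nil xs ys : {subset xs <= s} -> {subset ys <= s} -> xs = [::] \/ ys = [::] ->
    alt_pair true n.+2 (map p xs) (map q ys) = false.
  move=> xss yss xy; apply/negP => /(alt_pair_size (p_disjoint Ks xss yss)) /=[].
  by case: xy => ->.
rewrite alt_nil //; last by left.
rewrite alt_nil //; last by right.
rewrite !addbF /transfer {2}/alt_cochain /reverse_flip split_sum_rev.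
transitivity (split_sum (fun xs ys => alt_pair true n.+3 (map p xs) (map q ys) (+)
   alt_pair false n.+3 (map p xs) (map q ys)) s).
  apply: eq_split_sum => xs ys xss yss _ _ _.
  rewrite -coboundary_alt_pair ?(p_disjoint Ks) //.
  by rewrite (coboundary_map p (fun t => alt_pair true n.+2 t (map q ys)))
    (coboundary_map q (alt_pair true n.+2 (map p xs))).
rewrite split_sumD; congr (_ (+) _).
rewrite /split_sum size_map; apply: eq_bigr => i _.
rewrite -(@alt_pair_swap _ true).
  apply: alt_pair_perm.
    rewrite -map_drop map_rev /=; rewrite perm_sym perm_rev -map_comp.
    by rewrite perm_refl.
  rewrite -map_take map_rev perm_sym perm_rev -map_comp.
  by rewrite (eq_map (_ : _ =1 p)) // => x /=; rewrite /q /= nuK.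
by apply: (p_disjoint Ks) => x; [apply: mem_take|apply: mem_drop].
Qed.

(** A Borsuk-Ulam theorem in the manner of Ky Fan: the number of alternating
    simplices on the sphere is odd. Passing from [n] to [n.+1] moves the
    coboundary to the chain; on a pair of antipodal points exactly one of the
    two orders of their colors is increasing. *)
Lemma transfer_alt_cochain_hemisphere D e n : hemisphere_chains D K e -> n <= D ->
  pairing (transfer (alt_cochain n)) (e n).
Proof.
move=> [[v ev] eK ed]; elim: n => [|n IHn] nD.
  have Kv : K [:: v] by have [|//] := eK 0 [:: v] nD; rewrite ev mem_head.
  rewrite ev /pairing big_seq1 /transfer /alt_cochain /split_sum /= !big_ord1 /= /q /= nuK.
  have dis : ~~ has (mem [:: p v]) [:: q v] by apply: (@p_disjoint _ [:: v] [:: v] Kv).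
  have -> : alt_pair true 2 [:: p (nu v)] [:: p v] = alt_pair false 2 [:: p v] [:: q v].
    by rewrite -(@alt_pair_swap _ true).
  rewrite -(coboundary_alt_pair true 1 dis) /= !addbF.
  have -> : alt_pair true 1 [::] [:: q v] = false.
    by apply/negP => /(@alt_pair_size _ true 1 [::] [:: q v] isT)[].
  have := @coboundary_alt_pair _ true 0 [:: p v] [::] isT; rewrite /= !addbF.
  have -> : alt_pair false 1 [:: p v] [::] = false.
    by apply/negP => /(@alt_pair_size _ false 1 [:: p v] [::] isT)[].
  rewrite addbF => <-; rewrite /alt_pair /=.
  by elim: (enum C).
suff -> : pairing (transfer (alt_cochain n.+1)) (e n.+1) =
    pairing (transfer (alt_cochain n)) (e n) by exact: IHn (ltnW nD).
rewrite -(ed n (alt_cochain n)) //; apply: eq_pairing => s /eK[] // Ks _.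
by rewrite coboundary_alt_cochain.
Qed.

(** An alternating word of length [k.*2.+1] has [k.+1] letters of the first
    family. *)
Lemma palette_bound_odd D k e : hemisphere_chains D K e -> D.+2 = k.*2.+1 ->
  (forall s, K s -> size (undup (map p s)) <= k) -> False.
Proof.
move=> he Dk pk; have /negP := transfer_alt_cochain_hemisphere he (leqnn D); apply.
have [_ eK _] := he.
rewrite /pairing big_seq big1 // => s /(eK _ _ (leqnn D))[Ks szs].
suff alt0 t : K t -> alt_cochain D t = false by rewrite /transfer !alt0 //; exact: K_reverse_flip.
move=> Kt; rewrite /alt_cochain /split_sum big1 // => i _; apply/negP => alt.
have := alt_pair_size _ alt; rewrite Dk; case.
  by apply: (p_disjoint Kt) => x; [apply: mem_take|apply: mem_drop].
rewrite size_map /= doubleK => szi _.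
have := pk (take i.+1 t) (Ksub (fun x => @mem_take _ _ _ x) Kt).
by rewrite undup_id ?size_map ?szi ?ltnn //; case/and3P: alt.
Qed.

(** Cup products of classes of middle degree vanish on a sphere. Here
    [acyclic_at K k] is the vanishing of the cohomology in the middle degree
    [k.-1]. *)
Lemma palette_bound_even k e : k >= 2 -> hemisphere_chains k.-1.*2 K e -> acyclic_at K k ->
  (forall s, K s -> size (undup (map p s)) <= k) -> False.
Proof.
case: k => [//|k]; rewrite ltnS => k0; rewrite -pred_Sn => he Kac pk.
set D := k.*2 in he.
pose a (A : {set C}) xs := alt_pair true D.+2 (map p xs) (enum A).
have /fin_all_exists[u uP] (A : {set C}) : exists u,
    forall s, K s -> size s = k.+1 -> coboundary u s = a A s.
  apply: Kac => s Ks szs; rewrite /a (coboundary_map p (fun t => alt_pair true D.+2 t (enum A))).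
  apply: coboundary_nonuniq => [t t' tt'|t /negbTE ut|]; first exact: alt_pair_perm.
    by rewrite /alt_pair ut.
  apply/negP => us; have := pk _ Ks; rewrite undup_id // size_map szs.
  by rewrite ltnn.
(* The factors of the cup products, indexed by the set [A] of the [q]-colors;
   [F] replaces the first factor by a primitive of it. *)
pose one (A : {set C}) (ys : seq C) := perm_eq ys (enum A).
pose F xs ys := \big[addb/false]_(A : {set C} | #|A| == k.+1) (u A xs && one A (map q ys)).
have q_nuniq s : K s -> k.+1 < size s -> ~~ uniq (map q s).
  move=> Ks szs; apply/negP => us; have := pk _ (Knu Ks).
  by rewrite -map_comp undup_id // size_map leqNgt szs.
(* An alternating word of length [D.+2] has [k.+1] letters in each family, so on
   [D]-simplices the alternating cochain is the sum of these cup products. *)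
have DF s : K s -> size s = D.+1 -> alt_cochain D s = coboundary (split_sum F) s.
  move=> Ks szs; rewrite coboundary_split_sum.
  have -> : F [::] s = false.
    apply: big1 => A /eqP cA; apply/negP => /andP[_ /perm_size].
    rewrite size_map szs -cardE cA => -[]; rewrite /D -addnn => /eqP.
    by rewrite -{3}[k]addn0 eqn_add2l; case: (k) k0.
  have -> : F s [::] = false.
    by apply: big1 => A /eqP cA; apply/negP => /andP[_ /perm_size]; rewrite -cardE cA.
  rewrite !addbF; apply: eq_split_sum => xs ys xss yss.
  rewrite szs => szxy _ _.
  (* The second factors are cocycles. *)
  have -> : coboundary (F xs) ys = false.
    rewrite /F coboundary_sum big1 // => A cA.
    rewrite coboundaryZ (coboundary_map q (one A)).
    have [lty|] := ltnP k.+1 (size ys).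
      rewrite coboundary_nonuniq ?andbF //.
      + by move=> t t' tt'; rewrite /one (permPl tt').
      + move=> t; apply: contraNF => /perm_uniq ->; exact: enum_uniq.
      + by apply: q_nuniq => //; exact: Ksub yss Ks.
    move=> lty; rewrite -[coboundary _ _](_ : false = _) ?andbF // -[LHS](coboundary0 (map q ys)).
    apply: eq_coboundary => t _; rewrite size_map => szt; apply/esym/negP => /perm_size.
    rewrite -cardE (eqP cA) => szt'; by move: lty; rewrite -szt szt' ltnn.
  rewrite addbF coboundary_sum.
  have [alt|nalt] := boolP (alt_pair _ _ _ _).
    have [] := alt_pair_size (p_disjoint Ks xss yss) alt.
    rewrite !size_map /= doubleK uphalf_double => szx szy.
    have [_ uy _] := and3P alt.
    pose A := [set x in map q ys].
    have yA : perm_eq (map q ys) (enum A).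
      apply: uniq_perm => //; first exact: enum_uniq.
      by move=> x; rewrite mem_enum inE.
    have cA : #|A| = k.+1 by rewrite cardE -(perm_size yA) size_map.
    rewrite (bigD1 A) /= ?cA // big1 => [|A' /andP[_ A'A]].
      rewrite addbF {1}/one yA; under eq_coboundary do rewrite andbT.
      rewrite uP ?szx //; last exact: Ksub xss Ks.
      by rewrite /a -(alt_pair_perm _ _ (perm_refl _) yA).
    rewrite -[RHS](coboundary0 xs); apply: eq_coboundary => t _ _.
    rewrite /one (permPl yA); apply/negP => /andP[_ /perm_mem AA'].
    by case/eqP: A'A; apply/setP => x; have := AA' x; rewrite !mem_enum.
  apply/esym/big1 => A cA; have [yA|nyA] := boolP (one A (map q ys)); last first.
    by rewrite -[RHS](coboundary0 xs); apply: eq_coboundary => t _ _; rewrite andbF.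
  under eq_coboundary do rewrite andbT.
  have szy : size ys = k.+1 by rewrite -(size_map q) (perm_size yA) -cardE (eqP cA).
  rewrite uP; last 2 first.
  - exact: Ksub xss Ks.
  - by move: szxy; rewrite szy /D -addnn -addSn -addnS => /addIn.
  by rewrite /a -(alt_pair_perm _ _ (perm_refl _) yA) (negbTE nalt).
have /negP := transfer_alt_cochain_hemisphere he (leqnn D); apply.
have [_ eK ed] := he.
(* The transfer of a coboundary is the coboundary of a transfer; moved to the
   boundary of [e D], it is transferred once more, which gives zero. *)
have -> : pairing (transfer (alt_cochain D)) (e D) =
    pairing (coboundary (transfer (split_sum F))) (e D).
  apply: eq_pairing => s /(eK _ _ (leqnn D))[Ks szs].
  by rewrite -transfer_coboundary /transfer !DF ?size_reverse_flip //; exact: K_reverse_flip.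
have -> : D = D.-1.+1 by rewrite prednK // double_gt0.
rewrite ed ?prednK // ?double_gt0 //.
by rewrite /pairing big1 // => s _; rewrite transferK0.
Qed.

End Coloring.
End Antipodal.

(** * The grid on the boundary of a cube *)

Section Grid.
Variables (m N : nat).
Hypothesis N_gt0 : (0 < N)%N.
Local Notation point := {ffun 'I_m -> int}.
Implicit Types (x y : point) (s t : seq point) (P : pred point) (i : nat).

Definition adjacent_points x y := [forall j, `|x j - y j| <= 1]%R.

Definition clique P s : bool := all P s && all (fun x => all (adjacent_points x) s) s.

Lemma cliqueP P s : reflect ({in s, forall x, P x} /\
  {in s &, forall x y j, (`|x j - y j| <= 1)%R}) (clique P s).
Proof.
apply: (iffP andP) => [[/allP sP /allP sa]|[sP sa]]; split.
- by [].
- by move=> x y /sa/allP xs /xs/forallP.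
- exact/allP.
- by apply/allP => x xs; apply/allP => y ys; apply/forallP => j; apply: sa.
Qed.

Lemma clique_sub P : subset_closed (clique P).
Proof.
move=> s t st /cliqueP[tP ta]; apply/cliqueP; split=> [x /st/tP //|x y xs ys j].
by apply: ta; apply: st.
Qed.

Definition flip x : point := [ffun j => - x j]%R.

Lemma flipK : involutive flip.
Proof. by move=> x; apply/ffunP => j; rewrite !ffunE opprK. Qed.

(** The grid points on the boundary of the cube of half-side [N], cut by the
    coordinate subspace of the first [i.+1] coordinates: a sphere of dimension
    [i]. *)
Definition cube_sphere i : pred point := fun x =>
  [&& [forall j, `|x j| <= N%:Z], [forall j : 'I_m, (i < j)%N ==> (x j == 0)]
    & [exists j, `|x j| == N%:Z]]%R.

Lemma cube_sphereP i x : reflect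
  [/\ forall j, (`|x j| <= N%:Z)%R, forall j : 'I_m, (i < j)%N -> x j = 0%R
    & exists j, (`|x j| = N%:Z)%R] (cube_sphere i x).
Proof.
apply: (iffP and3P) => -[].
  move=> /forallP x1 /forallP x2 /existsP[k /eqP x3]; split=> //; last by exists k.
  by move=> j ij; apply/eqP; have /implyP := x2 j; apply.
move=> x1 x2 [k x3]; split; [exact/forallP| |by apply/existsP; exists k; apply/eqP].
by apply/forallP => j; apply/implyP => /x2 ->.
Qed.

Definition hemisphere i : pred point := fun x =>
  cube_sphere i x && [forall j : 'I_m, (j == i :> nat) ==> (0 <= x j)%R].

Lemma hemisphereP i x : reflect
  (cube_sphere i x /\ forall j : 'I_m, j = i :> nat -> (0 <= x j)%R) (hemisphere i x).
Proof.
apply: (iffP andP) => -[xS xi]; split=> //.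
  by move=> j /eqP ji; have /implyP := forallP xi j; apply.
by apply/forallP => j; apply/implyP => /eqP; exact: xi.
Qed.

Lemma clique_flip P P' s : (forall x, P x -> P' (flip x)) -> clique P s -> clique P' (map flip s).
Proof.
move=> PP' /cliqueP[sP sa]; apply/cliqueP; split=> [_ /mapP[x xs ->]|].
  by apply: PP'; apply: sP.
by move=> _ _ /mapP[x xs ->] /mapP[y ys ->] j; rewrite !ffunE; have := sa x y xs ys j; lia.
Qed.

Lemma clique_mono P P' s : {subset P <= P'} -> clique P s -> clique P' s.
Proof. by move=> PP' /cliqueP[sP sa]; apply/cliqueP; split=> // x /sP; apply: PP'. Qed.

Lemma cube_sphere_flip i x : cube_sphere i x -> cube_sphere i (flip x).
Proof.
move=> /cube_sphereP[x1 x2 [k x3]]; apply/cube_sphereP; split=> [j|j ij|].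
- by rewrite ffunE normrN.
- by rewrite ffunE x2 ?oppr0.
- by exists k; rewrite ffunE normrN.
Qed.

Lemma cube_sphere_widen i k x : i <= k -> cube_sphere i x -> cube_sphere k x.
Proof.
move=> ik /cube_sphereP[x1 x2 x3]; apply/cube_sphereP; split=> // j kj.
by apply: x2; apply: leq_ltn_trans kj.
Qed.

Lemma cube_sphere_hemisphere i x : cube_sphere i x -> hemisphere i.+1 x.
Proof.
move=> xS; apply/hemisphereP; split; first exact: cube_sphere_widen xS.
by have /cube_sphereP[_ x2 _] := xS; move=> j ji; rewrite x2 ?ji.
Qed.

(** The equator is the sphere of the previous dimension. *)
Lemma hemisphere_flip i x : i.+1 < m ->
  hemisphere i.+1 x && hemisphere i.+1 (flip x) = cube_sphere i x.
Proof.
move=> im; apply/idP/idP => [/andP[/hemisphereP[/cube_sphereP[x1 x2 x3] x4] /hemisphereP[_ x5]]|xS].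
  apply/cube_sphereP; split=> // j; rewrite leq_eqVlt => /orP[/eqP ij|]; last exact: x2.
  by have := x4 j (esym ij); have := x5 j (esym ij); rewrite ffunE; lia.
by rewrite !cube_sphere_hemisphere //; exact: cube_sphere_flip.
Qed.

(** Up to time [N] the points of the hemisphere rise to the face [x_i = N] of
    the cube; from then on this face shrinks to its center. No coordinate moves
    by more than 1 in a unit of time, even in comparison with a close point. *)
Definition contraction i (k : nat) x : point :=
  [ffun j : 'I_m => if (j == i :> nat) then Num.max (x j) (minn k N)%:Z%R
     else let r := (minn N (N.*2 - k))%:Z in Num.max (- r) (Num.min (x j) r)]%R.

Lemma contraction_hemisphere i k x : i < m -> hemisphere i x -> hemisphere i (contraction i k x).
Proof.
move=> im /hemisphereP[/cube_sphereP[x1 x2 [h x3]] x4]; apply/hemisphereP; split; last first.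
  by move=> j ji; rewrite ffunE ji eqxx; have := x4 j ji; lia.
apply/cube_sphereP; split.
- by move=> j; rewrite ffunE; have := x1 j; case: eqP => _ /=; lia.
- move=> j ij; rewrite ffunE x2 // gtn_eqF //=; lia.
- have [kN|Nk] := ltnP k N.
    exists h; rewrite ffunE; have := x4 h; case: eqP => [hi /(_ hi)|_ _] /=; lia.
  exists (Ordinal im); rewrite ffunE eqxx; have := x1 (Ordinal im).
  by have := x4 (Ordinal im) erefl; lia.
Qed.

Definition pole i : point := [ffun j : 'I_m => if (j == i :> nat) then N%:Z else 0]%R.

Lemma pole_hemisphere i : i < m -> hemisphere i (pole i).
Proof.
move=> im; apply/hemisphereP; split; last by move=> j ji; rewrite ffunE ji eqxx.
apply/cube_sphereP; split=> [j|j ij|].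
- by rewrite ffunE; case: eqP => _; lia.
- by rewrite ffunE gtn_eqF.
- by exists (Ordinal im); rewrite ffunE eqxx; lia.
Qed.

Lemma hemisphere_contractible i : i < m -> contractible (clique (hemisphere i)).
Proof.
move=> im; apply: (@contractible_homotopy _ _ (contraction i) N.*2 (pole i)).
- move=> s /cliqueP[sP _]; rewrite -[RHS]map_id; apply/eq_in_map => x /sP.
  move=> /hemisphereP[/cube_sphereP[x1 _ _] x4]; apply/ffunP => j; rewrite ffunE.
  by have := x1 j; case: eqP => [/x4|_] /=; lia.
- move=> k s /cliqueP[sP sa]; apply/cliqueP; split=> [x|].
    by rewrite mem_cat => /orP[]/mapP[y /sP ys ->]; apply: contraction_hemisphere.
  have close k' k'' x y j : x \in s -> y \in s -> (k' <= k''.+1)%N -> (k'' <= k'.+1)%N ->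
      (`|contraction i k' x j - contraction i k'' y j| <= 1)%R.
    move=> xs ys kk kk'; rewrite !ffunE; have := sa x y xs ys j.
    by case: eqP => _ /=; lia.
  move=> x y; rewrite !mem_cat => /orP[]/mapP[x' xs ->] /orP[]/mapP[y' ys ->] j;
    apply: close => //; lia.
- move=> s /cliqueP[sP sa].
  have fE x : x \in s -> contraction i N.*2 x = pole i.
    move=> /sP/hemisphereP[/cube_sphereP[x1 _ _] x4]; apply/ffunP => j; rewrite !ffunE.
    by have := x1 j; case: eqP => [/x4|_] /=; lia.
  have sE x : x \in pole i :: map (contraction i N.*2) s -> x = pole i.
    by rewrite inE => /orP[/eqP //|/mapP[y /fE <- ->]].
  apply/cliqueP; split=> [x /sE ->|x y /sE -> /sE -> j]; first exact: pole_hemisphere.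
  by rewrite subrr.
- exact: clique_sub.
Qed.

Lemma clique_sphere_cover i s : i < m -> clique (cube_sphere i) s =
  clique (hemisphere i) s || clique (hemisphere i) (map flip s).
Proof.
move=> im; apply/idP/orP; last first.
  case; first by apply: clique_mono => x /hemisphereP[].
  move=> /(clique_flip (P' := cube_sphere i)); rewrite mapK; last exact: flipK.
  by apply=> x /hemisphereP[/cube_sphere_flip].
move=> /cliqueP[sP sa]; have [|/allPn[x xs]] := boolP (all (fun x => (0 <= x (Ordinal im))%R) s).
  move=> /allP s0; left; apply/cliqueP; split=> // x xs; apply/hemisphereP.
  split=> [|j ji]; first exact: sP.
  by have := s0 x xs; congr (0 <= x _)%R; apply: val_inj.
(* A clique with a point below the equator has none above it, because the
   coordinates are integers that differ by at most 1. *)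
move=> x0; right; apply: (@clique_flip (fun y => cube_sphere i y && (y (Ordinal im) <= 0)%R)).
  move=> y /andP[yS y0]; apply/hemisphereP; split; first exact: cube_sphere_flip.
  move=> j ji; rewrite ffunE oppr_ge0; by rewrite (_ : j = Ordinal im) //; exact: val_inj.
apply/cliqueP; split=> // y ys; rewrite sP //=.
by have := sa x y xs ys (Ordinal im); lia.
Qed.

(** A sphere is the union of two contractible hemispheres that meet in the
    equator. *)
Lemma cube_sphere_acyclic i n : i < m -> n <= i -> acyclic_at (clique (cube_sphere i)) n.
Proof.
have base k : k < m -> acyclic_at (clique (cube_sphere k)) 0.
  move=> km a a0; exists (fun=> false) => s _ /size0nil ->.
  rewrite /= -(a0 [:: pole k]) //= ?addbF //.
  apply/cliqueP; split=> [x|x y]; rewrite !inE => /eqP->.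
    by have /hemisphereP[] := pole_hemisphere km.
  by move=> /eqP-> j; rewrite subrr.
elim: i n => [|i IHi] [|n] im ni //; [exact: base|exact: base|].
apply: (@acyclic_union _ _ (clique (hemisphere i.+1))
    (fun s => clique (hemisphere i.+1) (map flip s))).
- exact: clique_sub.
- exact: clique_sub.
- by move=> s t st; apply: clique_sub => _ /mapP[x /st xt ->]; exact: map_f.
- by move=> s; exact: clique_sphere_cover.
- exact: contractible_acyclic (hemisphere_contractible im).
- move=> a a0.
  have [|u uP] := contractible_acyclic (n := n.+1) (hemisphere_contractible im)
      (a := fun s => a (map flip s)).
    move=> s sH szs; rewrite (coboundary_map flip a) a0 ?size_map //.
    by rewrite (mapK flipK).
  exists (fun s => u (map flip s)) => s sH szs.
  by rewrite (coboundary_map flip u) uP ?size_map // (mapK flipK).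
- have KE s : predI (clique (hemisphere i.+1))
      (fun s => clique (hemisphere i.+1) (map flip s)) s = clique (cube_sphere i) s.
    apply/andP/idP => [[/cliqueP[sP sa] /cliqueP[sP' _]]|].
      apply/cliqueP; split=> // x xs; rewrite -hemisphere_flip // sP //=.
      by apply: sP'; exact: map_f.
    move=> sS; split; first by apply: clique_mono sS => x; exact: cube_sphere_hemisphere.
    by apply: clique_flip sS => x /cube_sphere_flip; exact: cube_sphere_hemisphere.
  move=> a a0; have [|u uP] := IHi n (ltnW im) ni a.
    by move=> s sS szs; apply: a0; rewrite ?KE.
  by exists u => s; rewrite KE; exact: uP.
Qed.

Lemma cube_sphere_chains D : D < m ->
  exists e, hemisphere_chains flip D (clique (cube_sphere D)) e.
Proof.
move=> Dm; have [|||e [e0 eK ed]] := @hemisphere_chains_exist _ _ flipK D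
    (fun i => clique (hemisphere i)) (pole 0).
- by move=> i iD; apply: hemisphere_contractible; exact: leq_ltn_trans Dm.
- move=> i s iD sH; apply/andP; split.
    by apply: clique_mono sH => x /hemisphereP[+ _]; exact: cube_sphere_hemisphere.
  apply: (@clique_sub _ _ (map flip s)) => [x|]; first by rewrite mem_rev.
  by apply: clique_flip sH => x /hemisphereP[/cube_sphere_flip + _]; exact: cube_sphere_hemisphere.
- apply/cliqueP; split=> [x|x y]; rewrite !inE => /eqP->.
    by apply: pole_hemisphere; exact: leq_ltn_trans Dm.
  by move=> /eqP-> j; rewrite subrr.
exists e; split=> // i s iD /(eK _ _ iD)[sH ->]; split=> //.
by apply: clique_mono sH => x /hemisphereP[].
Qed.

(** For odd [D] the number of letters of an alternating word suffices; for even
    [D] it only gives [D.+2./2 <= k], and the vanishing of cup products in the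
    middle degree excludes equality. *)
Theorem local_palette_bound (C : finType) (p : point -> C) (D k : nat) : D < m -> 0 < D ->
  {in cube_sphere D &, forall x y, adjacent_points x y -> p x != p (flip y)} ->
  (forall s, clique (cube_sphere D) s -> size (undup (map p s)) <= k) ->
  D.+2./2 < k.
Proof.
move=> Dm D0 pp pk; rewrite ltnNge; apply/negP => kD.
have {}pk s : clique (cube_sphere D) s -> size (undup (map p s)) <= D.+2./2.
  by move=> /pk sk; exact: leq_trans kD.
have [e he] := cube_sphere_chains Dm.
have Knu s : clique (cube_sphere D) s -> clique (cube_sphere D) (map flip s).
  by apply: clique_flip => x; exact: cube_sphere_flip.
have Kp s x y : clique (cube_sphere D) s -> x \in s -> y \in s -> p x != p (flip y).
  move=> /cliqueP[sP sa] xs ys; apply: pp; [exact: sP|exact: sP|].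
  by apply/forallP => j; exact: sa.
have [oddD|evenD] := boolP (odd D).
  apply: (palette_bound_odd flipK (@clique_sub _) Knu Kp he _ pk).
  by rewrite -[LHS]odd_double_half /= negbK oddD.
(* [D] is twice the cohomological degree, one less than the number of colors. *)
have DE : D = (D.+2./2).-1.*2 by rewrite /= -[LHS]odd_double_half (negbTE evenD).
apply: (palette_bound_even (k := D.+2./2) flipK (@clique_sub _) Knu Kp _ _ _ pk (e := e)).
- by move: D0 DE; rewrite /=; case: (D./2) => [|h] //= D0 D1; rewrite D1 in D0.
- by rewrite -DE.
- apply: cube_sphere_acyclic => //; rewrite /=; lia.
Qed.

End Grid.

(** * From an antipodal map to a labelling of the grid *)

Local Open Scope classical_set_scope.
Local Open Scope ring_scope.

(** The theorem of Heine and Cantor, with the moduli [1 / n.+1] so that finitely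
    many functions share one. *)
Lemma compact_uniformly_continuous (R : realType) (E : normedModType R)
    (K : set E) (F : E -> R) (e : R) :
  compact K -> (forall x, K x -> {for x, continuous F}) -> 0 < e ->
  \forall n \near \oo, forall x y, K x -> K y ->
     `|x - y| <= n.+1%:R^-1 -> `|F x - F y| < e.
Proof.
move=> /compact_near_coveringP/(_ nat \oo) cK cF e0.
have := cK (fun n x => K x -> forall y, K y -> `|x - y| <= n.+1%:R^-1 -> `|F x - F y| < e).
move=> /(_ _)[x Kx|N _ HN]; last first.
  by exists N => // n /= Nn x y Kx Ky; apply: (HN n Nn).
have e20 : 0 < e / 2 by rewrite divr_gt0.
have /cvgrPdist_lt/(_ _ e20) := cF x Kx.
rewrite -nbhs_ballE => -[d /= d0 xd].
have d20 : 0 < d / 2 by rewrite divr_gt0.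
have nx : \forall x' \near x, `|x - x'| < d / 2.
  by have /cvgrPdist_lt/(_ _ d20) := @cvg_id _ (nbhs x).
near=> x' n => /= Kx' y Ky x'y.
have xx' : `|x - x'| < d / 2 by near: x'.
have nd : n.+1%:R^-1 < d / 2.
  by near: n; have := @near_infty_natSinv_lt R (PosNum d20).
have Fx' : `|F x - F x'| < e / 2.
  apply: xd; rewrite /= -ball_normE /ball_ /=; apply: lt_trans xx' _; lra.
have Fy : `|F x - F y| < e / 2.
  apply: xd; rewrite /= -ball_normE /ball_ /=.
  apply: le_lt_trans (ler_distD x' _ _) _; rewrite (splitr d).
  by apply: ltrD => //; exact: le_lt_trans x'y nd.
apply: le_lt_trans (ler_distD (F x) _ _) _; rewrite (splitr e) distrC.
exact: ltrD.
Unshelve. all: by end_near. Qed.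

Section Sphere.
Variables (R : realType) (d : nat).
Local Notation E := 'rV[R]_d.+1.
Implicit Types (x y : E).

Definition sq_norm x : R := \sum_(i < d.+1) x ord0 i ^+ 2.

Definition radial x : E := (Num.sqrt (sq_norm x))^-1 *: x.

(** The norm of row vectors is the sup norm, whose unit sphere is the boundary
    of the cube on which the grid lies. *)
Definition cube_boundary : set E := [set x | `|x| = 1].

Lemma cube_boundary_compact : compact cube_boundary.
Proof.
apply: bounded_closed_compact.
  by exists 1; split=> // M M1 x /= ->; exact: ltW.
have -> : cube_boundary = (fun x => `|x|) @^-1` [set 1 : R] by [].
apply: closed_comp => [x _|]; first exact: norm_continuous.
exact: closed_eq.
Qed.

Lemma sq_norm_gt0 x : cube_boundary x -> 0 < sq_norm x.
Proof.
move=> /= x1; have /mx_norm_neq0[[i j]] : mx_norm x != 0.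
  by rewrite -[mx_norm x]/(`|x|) x1 oner_neq0.
rewrite -[mx_norm x]/(`|x|) x1 /= (ord1 i) => xj.
rewrite /sq_norm (bigD1 j) //= ltr_pwDl //; last first.
  by apply: sumr_ge0 => k _; exact: sqr_ge0.
by rewrite -real_normK ?num_real // -xj expr1n.
Qed.

Lemma radial_sphere x : 0 < sq_norm x -> unit_sphere (radial x).
Proof.
move=> x0; rewrite /unit_sphere /= /radial.
under eq_bigr do rewrite mxE exprMn.
by rewrite -big_distrr /= exprVn sqr_sqrtr ?ltW // mulVf // gt_eqF.
Qed.

Lemma sq_norm_continuous : continuous sq_norm.
Proof.
apply: continuous_big => [|i _ x]; first exact: add_continuous.
apply: (@continuous_comp _ _ _ (fun x : E => x ord0 i) (fun t => t ^+ 2)).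
  exact: coord_continuous.
exact: exprn_continuous.
Qed.

Lemma radial_continuous x : 0 < sq_norm x -> {for x, continuous radial}.
Proof.
move=> x0; have sqrt_cvg : Num.sqrt (sq_norm y) @[y --> x] --> Num.sqrt (sq_norm x).
  exact: (cvg_comp _ _ (@sq_norm_continuous x) (@sqrt_continuous R (sq_norm x))).
have sqrt_neq0 : Num.sqrt (sq_norm x) != 0 by rewrite gt_eqF // sqrtr_gt0.
exact: (cvgZ (cvgV sqrt_neq0 sqrt_cvg) (@cvg_id _ (nbhs x))).
Qed.

Lemma sphere_inhabited : unit_sphere (delta_mx 0 0 : E).
Proof.
rewrite /unit_sphere /= (bigD1 ord0) //= mxE !eqxx expr1n big1 ?addr0 // => i i0.
by rewrite mxE (negbTE i0) andbF expr0n.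
Qed.

(** The default value only serves at the origin. *)
Definition to_sphere x : sphere R d :=
  insubd (exist (fun y => y \in @unit_sphere R d) (delta_mx 0 0 : E)
    (mem_set sphere_inhabited) : sphere R d) (radial x).

Lemma val_to_sphere x : 0 < sq_norm x -> val (to_sphere x) = radial x.
Proof. by move=> x0; rewrite /to_sphere insubdK //; apply/mem_set/radial_sphere. Qed.

Lemma to_sphereN x : 0 < sq_norm x -> to_sphere (- x) = z2_inv (to_sphere x).
Proof.
move=> x0; have sqN : sq_norm (- x) = sq_norm x.
  by apply: eq_bigr => i _; rewrite mxE sqrrN.
apply: val_inj; rewrite /= !val_to_sphere ?sqN //.
by rewrite /radial sqN scalerN.
Qed.

Lemma to_sphere_continuous x : 0 < sq_norm x -> {for x, continuous to_sphere}.
Proof.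
move=> x0 U [W [[V oV <-] Vx] sWU].
have Vr : \forall y \near x, V (radial y).
  apply: (radial_continuous x0); apply: open_nbhs_nbhs; split=> //.
  have xE : set_val (to_sphere x) = radial x by exact: val_to_sphere.
  by rewrite -xE.
have y0 : \forall y \near x, 0 < sq_norm y.
  by have /cvgr_gt := @sq_norm_continuous x; apply.
suff : \forall y \near x, U (to_sphere y) by [].
near=> y; apply: sWU.
have yE : set_val (to_sphere y) = radial y by apply: val_to_sphere; near: y.
by change (V (set_val (to_sphere y))); rewrite yE; near: y.
Unshelve. all: by end_near. Qed.

End Sphere.

Section Labelling.
Variables (R : realType) (G : sgraph) (d : nat) (f : sphere R d -> hom_space G R).
Hypothesis f_map : z2_map f.
Local Notation E := 'rV[R]_d.+1.

(** The coordinates of the image in the geometric realization. *)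
Definition weight (x : E) (k : G * bool) : R := val (val (f (to_sphere x))) k.

Lemma weight_continuous x k : 0 < sq_norm x -> {for x, continuous (weight^~ k)}.
Proof.
move=> x0; have [f_cont _] := f_map.
have c1 := cvg_comp _ _ (to_sphere_continuous x0) (f_cont (to_sphere x)).
have c2 := cvg_comp _ _ c1 (@initial_continuous _ _ set_val (f (to_sphere x))).
have c3 := cvg_comp _ _ c2
  (@initial_continuous _ _ set_val (set_val (f (to_sphere x)))).
exact: (cvg_comp _ _ c3 (@proj_continuous (G * bool)%type (fun=> R) k _)).
Qed.

Lemma weightN x v b : 0 < sq_norm x -> weight (- x) (v, b) = weight x (v, ~~ b).
Proof. by move=> x0; rewrite /weight to_sphereN // f_map.2. Qed.

Lemma weight_sum x : \sum_(v : G) weight x (v, false) = 2^-1.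
Proof. exact: (set_mem (valP (f (to_sphere x)))). Qed.

Lemma weight_adj x u v : 0 < weight x (u, false) -> 0 < weight x (v, true) -> adj u v.
Proof.
have [_ _ [K [S [T [-> _ ST]]] K0]] := set_mem (valP (val (f (to_sphere x)))).
move=> u0 v0; apply: ST; apply: contraTT isT => notin.
  move: u0; rewrite /weight K0 ?ltxx // !inE /=.
  by rewrite (negbTE notin) !andbF.
move: v0; rewrite /weight K0 ?ltxx // !inE /=.
by rewrite (negbTE notin) !andbF.
Qed.

(** The weights on the first side add up to one half. *)
Lemma weight_large x : exists u, (2 * #|G|%:R)^-1 <= weight x (u, false).
Proof.
apply: contrapT => /forallNP small; have := weight_sum x.
have [G0|/card_gt0P[u0 _]] := posnP #|G|.
  rewrite big_pred0 => [/esym/eqP|u]; last by have := card0_eq G0 u.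
  by rewrite invr_eq0 pnatr_eq0.
have G0 : (0 < #|G|)%N by apply/card_gt0P; exists u0.
suff : \sum_(v : G) weight x (v, false) < 2^-1 by move=> + eq2; rewrite eq2 ltxx.
have -> : 2^-1 = \sum_(v : G) (2 * #|G|%:R)^-1 :> R.
  by rewrite sumr_const -[RHS]mulr_natr invfM -mulrA mulVf ?mulr1 // pnatr_eq0 -lt0n.
apply: ltr_sum => [|v _]; first by apply/hasP; exists u0; rewrite ?mem_index_enum.
by rewrite ltNge; apply/negP; exact: small.
Qed.

Definition grid_point N (x : {ffun 'I_d.+1 -> int}) : E := \row_j ((x j)%:~R / N%:R).

Lemma grid_point_flip N x : grid_point N (flip x) = - grid_point N x.
Proof. by apply/rowP => j; rewrite !mxE ffunE mulrNz mulNr. Qed.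

Lemma mx_norm_le (x : E) (e : R) : 0 <= e -> (forall j, `|x ord0 j| <= e) -> `|x| <= e.
Proof.
move=> e0 xe; rewrite [leLHS]/Num.norm /= mx_normrE; apply/bigmax_leP; split=> // -[i j] _ /=.
by rewrite (ord1 i).
Qed.

Lemma le_mx_norm (x : E) j : `|x ord0 j| <= `|x|.
Proof.
rewrite [leRHS]/Num.norm /= mx_normrE; apply/bigmax_geP; right => /=.
by exists (ord0, j).
Qed.

Lemma grid_point_norm N x : (0 < N)%N -> cube_sphere N d x -> cube_boundary (grid_point N x).
Proof.
move=> N0 /cube_sphereP[xN _ [k xk]].
have NR0 : 0 < N%:R :> R by rewrite ltr0n.
have coordE j : `|grid_point N x ord0 j| = `|x j|%:~R / N%:R.
  by rewrite mxE normrM normfV (gtr0_norm NR0) intr_norm.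
apply/eqP; rewrite eq_le mx_norm_le //=; last first.
  by move=> j; rewrite coordE ler_pdivrMr // mul1r -[N%:R]/(N%:Z%:~R) ler_int.
by have := le_mx_norm (grid_point N x) k; rewrite coordE xk mulfV // gt_eqF.
Qed.

Lemma grid_point_close N x y : (0 < N)%N -> adjacent_points x y ->
  `|grid_point N x - grid_point N y| <= N%:R^-1.
Proof.
move=> N0 /forallP xy; apply: mx_norm_le => [|j]; first by rewrite invr_ge0.
rewrite !mxE -mulrBl -intrB normrM normfV normr_nat ler_piMl ?invr_ge0 //.
by rewrite -intr_norm -[1]/(1%:~R) ler_int.
Qed.

(** The vertex [u x] has a large weight at [x] on the first side, and
    [u (flip y)] has a large weight at [y] on the second side, hence a positive
    one at [x]. Both then lie in the simplex that supports the image of [x]. *)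
Lemma antipodal_labelling : exists2 N, (0 < N)%N &
  exists u : {ffun 'I_d.+1 -> int} -> G,
  {in cube_sphere N d &, forall x y, adjacent_points x y -> adj (u x) (u (flip y))}.
Proof.
(* The labels have weight at least [e], so a change of all weights by less than
   [e] keeps the weight of a label positive. *)
pose e : R := (2 * #|G|%:R)^-1.
have e0 : 0 < e.
  have [u _] := weight_large 0; rewrite invr_gt0 mulr_gt0 // ltr0n.
  by apply/card_gt0P; exists u.
have : \forall n \near \oo, forall k x y, cube_boundary x -> cube_boundary y ->
     `|x - y| <= n.+1%:R^-1 -> `|weight x k - weight y k| < e.
  apply: filter_forall => k.
  apply: compact_uniformly_continuous => //; first exact: cube_boundary_compact.
  by move=> x /sq_norm_gt0; exact: weight_continuous.
move=> [n _ /(_ n (leqnn n)) unif]; exists n.+1 => //.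
have /choice[w wP] := weight_large.
exists (fun x => w (grid_point n.+1 x)) => x y xS yS xy.
have Bx := grid_point_norm (ltn0Sn n) xS; have By := grid_point_norm (ltn0Sn n) yS.
apply: (@weight_adj (grid_point n.+1 x)); first exact: lt_le_trans (wP _).
have := unif (w (grid_point n.+1 (flip y)), true) _ _ By Bx.
rewrite distrC => /(_ (grid_point_close (ltn0Sn n) xy)).
have := wP (grid_point n.+1 (flip y)); rewrite {1}grid_point_flip weightN ?sq_norm_gt0 //=.
rewrite -/e ltr_norml => ey /andP[_].
by rewrite ltrBlDr => /(le_lt_trans ey); rewrite ltrDl.
Qed.

End Labelling.

(** * The bound on the local chromatic number *)

Local Close Scope ring_scope.
Local Close Scope classical_set_scope.

Lemma coind_sphere_map (R : realType) (T : z2space) (n : nat) :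
  (n%:R%:E <= coind R T)%E ->
  exists2 d, (n <= d)%N & exists f : sphere R d -> T, z2_map f.
Proof.
move=> nT; have /ereal_sup_gt[_ [d Td <-]] : ((n%:R - 1)%:E < coind R T)%E.
  by apply: lt_le_trans nT; rewrite lte_fin ltrBlDr ltrDl ltr01.
by rewrite lte_fin ltrBlDr natr1 ltr_nat ltnS => nd; exists d.
Qed.

(** A coloring that attains the minimum. *)
Lemma local_chromaticP (G : sgraph) : exists2 c : G -> nat,
  proper_coloring c & forall v, (nb_colors c v < local_chromatic G)%N.
Proof.
rewrite /local_chromatic; case: ex_minnP => k /asboolP[c cP ->] _.
by exists c => // v; rewrite addn1 ltnS; exact: leq_bigmax.
Qed.

Theorem theorem3 (R : realType) (G : sgraph) (t : nat) (ht : (3 <= t)%N)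
  (hG : strongly_topologically_chromatic R G t) :
  (t %/ 2 + 2 <= local_chromatic G)%N.
Proof.
(* The sphere may have a larger dimension than [t - 2]; its equator is used. *)
have [|d td [f f_map]] := @coind_sphere_map R (hom_space G R) (t - 2).
  by rewrite natrB //; exact: ltnW.
have [N N0 [u uP]] := antipodal_labelling f_map.
have [c cP cl] := local_chromaticP G.
pose p (x : {ffun 'I_d.+1 -> int}) : 'I_(\max_(v : G) c v)%N.+1 := inord (c (u x)).
have c_inord (v : G) : @inord (\max_(v : G) c v)%N (c v) = c v :> nat.
  by rewrite inordK // ltnS; exact: leq_bigmax.
have {}uP : {in cube_sphere N (t - 2) &, forall x y, adjacent_points x y -> adj (u x) (u (flip y))}.
  move=> x y xS yS; apply: uP; exact: cube_sphere_widen td _.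
have tE : (t %/ 2 = (t - 2).+2./2)%N by rewrite -divn2; congr (_ %/ 2)%N; lia.
rewrite addn2 tE -(prednK (leq_ltn_trans (leq0n _) (cl (u [ffun=> 0%R])))) ltnS.
apply: (@local_palette_bound d.+1 N N0 _ p).
- by rewrite ltnS.
- by rewrite subn_gt0.
- move=> x y xS yS xy; apply/eqP => /(congr1 val); rewrite /p /= !c_inord.
  by apply: cP; exact: uP.
- case=> [|x0 s] // /cliqueP[sS sa].
  (* One vertex of [G] sees all the labels of the clique. *)
  have adj0 x : x \in x0 :: s -> adj (u (flip x0)) (u x).
    move=> xs; rewrite adj_sym; apply: uP; [exact: sS|by apply: sS; rewrite mem_head|].
    by apply/forallP => j; apply: sa; rewrite ?mem_head.
  rewrite -ltnS prednK; last exact: leq_ltn_trans (cl (u x0)).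
  apply: leq_ltn_trans (cl (u (flip x0))).
  pose cs := undup [seq c w | w <- enum G & adj (u (flip x0)) w].
  rewrite -[nb_colors _ _](size_map (fun i => inord i : 'I_(\max_(v : G) c v)%N.+1) cs).
  apply: uniq_leq_size; first exact: undup_uniq.
  move=> i; rewrite mem_undup => /mapP[x xs ->]; apply: map_f.
  by rewrite mem_undup; apply: map_f; rewrite mem_filter adj0 //= mem_enum.
Qed.
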